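(* Let $\alpha,\beta\ge 1$ be real numbers and let $j\in\mathbb{Q}$. For every $X>1$ the following formulas hold: $$\#\mathcal{E}_j(X;H_{\alpha,\beta})=\begin{cases}\dfrac{2}{\beta^{1/2}\zeta(6)}X^{1/2}+O(X^{1/12}) & \text{for } j=0,\\[6pt] \dfrac{2}{\alpha^{1/3}\zeta(4)}X^{1/3}+O(X^{1/12}) & \text{for } j=1728,\\[6pt] \dfrac{2c(j;H_{\alpha,\beta})}{\zeta(2)}X^{1/6}+O(X^{1/12}) & \text{for } j\neq 0,1728,\end{cases}$$ and $$\#\widetilde{\mathcal{E}}_j(X;H_{\alpha,\beta})=\begin{cases}2\left\lfloor\dfrac{X^{1/2}}{\beta^{1/2}}\right\rfloor & \text{for } j=0,\\[6pt] 2\left\lfloor\dfrac{X^{1/3}}{\alpha^{1/3}}\right\rfloor & \text{for } j=1728,\\[6pt] 2\left\lfloor c(j;H_{\alpha,\beta})X^{1/6}\right\rfloor & \text{for } j\neq 0,1728.\end{cases}$$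
   Context: For $(A,B)\in\mathbb{Z}^2$ let $E_{A,B}$ denote the curve $y^2=x^3+Ax+B$; curves are counted by their pairs $(A,B)$. Let $\widetilde{\mathcal{E}}$ be the set of all $E_{A,B}$ with $A,B\in\mathbb{Z}$ and $-16(4A^3+27B^2)\neq 0$, and let $\mathcal{E}$ be the set of $E_{A,B}\in\widetilde{\mathcal{E}}$ such that there is no prime $p$ with $p^4\mid A$ and $p^6\mid B$. The $j$-invariant is $j(E_{A,B})=1728\cdot\frac{4A^3}{4A^3+27B^2}$. For $j\in\mathbb{Q}$, $\widetilde{\mathcal{E}}_j:=\{E_{A,B}\in\widetilde{\mathcal{E}}: j(E_{A,B})=j\}$ and $\mathcal{E}_j:=\{E_{A,B}\in\mathcal{E}: j(E_{A,B})=j\}$. For real $\alpha,\beta\ge1$, $H_{\alpha,\beta}(E_{A,B}):=\max\{\alpha|A|^3,\beta B^2\}$, and for a family $\mathcal{F}$ and $X>0$, $\mathcal{F}(X;H_{\alpha,\beta}):=\{E_{A,B}\in\mathcal{F}: H_{\alpha,\beta}(E_{A,B})\le X\}$. For $a\in\mathbb{Q}^\times$ and a prime $p$, let $\alpha_p(a):=\lceil \operatorname{ord}_p(a)/2\rceil$ if $\operatorname{ord}_p(a)\ge0$ and $\alpha_p(a):=\lceil\operatorname{ord}_p(a)/3\rceil$ if $\operatorname{ord}_p(a)<0$, where $\operatorname{ord}_p$ is the $p$-adic valuation; let $N_a:=\prod_p p^{\alpha_p(a)}\in\mathbb{Q}^\times$ (product over all primes). For $j\in\mathbb{Q}\setminus\{0,1728\}$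 let $a(j):=\frac{4(1728-j)}{27j}$ and $$c(j;H_{\alpha,\beta}):=\min\left\{\frac{|a(j)|^{1/2}}{N_{a(j)}\alpha^{1/6}},\frac{|a(j)|^{1/3}}{N_{a(j)}\beta^{1/6}}\right\}.$$ $\zeta$ is the Riemann zeta function. The parameters $\alpha,\beta,j$ are fixed; implied constants in $O(\cdot)$ may depend on them. *)

(* Defs.v *)
From HB Require Import structures.
From mathcomp Require Import all_boot all_order all_algebra.
From mathcomp Require Import all_classical all_reals all_analysis.

Set Implicit Arguments.
Unset Strict Implicit.
Unset Printing Implicit Defensive.

Import Order.TTheory GRing.Theory Num.Theory.
Import numFieldNormedType.Exports.

Local Open Scope classical_set_scope.
Local Open Scope ring_scope.

(* The pair (A, B) stands for the curve y^2 = x^3 + A x + B; distinct pairs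
   are distinct elements of a family, even when the curves are isomorphic. *)
Notation curve := (int * int)%type.

Definition disc (E : curve) : int := - 16 * (4 * E.1 ^+ 3 + 27 * E.2 ^+ 2).

Definition jinv (E : curve) : rat :=
  1728 * ((4 * E.1 ^+ 3)%:~R / (4 * E.1 ^+ 3 + 27 * E.2 ^+ 2)%:~R).

Definition all_curves : set curve := [set E | disc E != 0].

Definition minimal_curves : set curve :=
  [set E | all_curves E /\
     ~ exists p : nat, [/\ prime p, ((p ^ 4)%N%:Z %| E.1)%Z
                          & ((p ^ 6)%N%:Z %| E.2)%Z]].

Definition with_j (F : set curve) (j : rat) : set curve :=
  [set E | F E /\ jinv E = j].

Definition height (R : realType) (alpha beta : R) (E : curve) : R :=
  Num.max (alpha * `|E.1%:~R| ^+ 3) (beta * E.2%:~R ^+ 2).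

Definition up_to_height (R : realType) (alpha beta : R) (F : set curve)
    (X : R) : set curve :=
  [set E | F E /\ height alpha beta E <= X].

(* p-adic valuation; meaningful for p prime and a != 0 *)
Definition ordq (p : nat) (a : rat) : int :=
  (logn p `|numq a|%N)%:Z - (logn p `|denq a|%N)%:Z.

Definition alpha_exp (p : nat) (a : rat) : int :=
  if 0 <= ordq p a then Num.ceil ((ordq p a)%:~R / 2 : rat)
  else Num.ceil ((ordq p a)%:~R / 3 : rat).

(* For a != 0 only finitely many factors differ from 1, so this
   finite-support product is the product over all primes. *)
Definition Nq (a : rat) : rat :=
  \big[*%R/1]_(p \in [set p : nat | prime p]) ((p%:R : rat) ^ alpha_exp p a).

Definition a_of_j (j : rat) : rat := 4 * (1728 - j) / (27 * j).

Definition c_of_j (R : realType) (j : rat) (alpha beta : R) : R :=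
  let a : R := ratr (a_of_j j) in
  let N : R := ratr (Nq (a_of_j j)) in
  Num.min (`|a| `^ 2^-1 / (N * alpha `^ 6^-1))
          (`|a| `^ 3^-1 / (N * beta `^ 6^-1)).

(* The Riemann zeta function on real s > 1, where its Dirichlet series
   sum_(n >= 1) 1 / n `^ s converges. *)
Definition zeta (R : realType) (s : R) : R := limn (series (riemannR s)).

(* Main.v *)
(* A curve with j-invariant j is (0, n) if j = 0, (n, 0) if j = 1728, and
   otherwise lies on B^2 = a A^3 with a = a(j), hence is (s^2/a, s^3/a) with
   s = B/A; comparing valuations, it is integral iff s = n N_a with n an
   integer. In each case the height condition reads |n| <= Y with
   Y = c X^(k/12), k = 6, 4, 2 respectively, which gives the exact count, and
   the curve is minimal iff n is k-free (dividing A by p^4 and B by p^6 divides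
   s by p^2).

   For N = floor Y, the number of k-free n <= N is the sum over d <= Y^(1/k) of
   mu(d) floor(N/d^k). Removing the floors and completing the series costs
   O(Y^(1/k)) = O(X^(1/12)), and the sum of mu(d)/d^k is 1/zeta(k): summing
   over n = d e <= D gives exactly
   sum_(d <= D) mu(d)/d^k (sum_(e <= D/d) 1/e^k) = 1, and replacing the inner
   sum by zeta(k) changes this by at most 2/D sum_(d <= D) 1/d, a Cesaro mean
   tending to 0. *)
Require Import Defs.
From HB Require Import structures.
From mathcomp Require Import all_boot all_order all_algebra.
From mathcomp Require Import finmap all_classical all_reals all_analysis.
From mathcomp Require Import ring lra zify.

Set Implicit Arguments.
Unset Strict Implicit.
Unset Printing Implicit Defensive.

Import Order.TTheory GRing.Theory Num.Theory.
Import numFieldNormedType.Exports.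

Local Open Scope classical_set_scope.
Local Open Scope ring_scope.

(** * Moebius function and k-free integers *)

(** A prime of exponent at least 2 contributes a factor 0, so this is the usual Möbius function on
    positive integers; [primes 0] is empty, so the value at 0 is 1. *)
Definition moebius (n : nat) : int :=
  \prod_(p <- primes n) (if logn p n == 1 then -1 else 0).

Lemma moebius_norm_le1 n : `|moebius n| <= 1.
Proof.
rewrite /moebius; elim/big_rec: _ => [|p x _ hx]; first by rewrite normr1.
by rewrite normrM; case: ifP => _; rewrite ?normrN1 ?mul1r // normr0 mul0r.
Qed.

Lemma moebius1 : moebius 1 = 1.
Proof. by rewrite /moebius big_nil. Qed.

Lemma moebius_prime_mul p e : prime p -> (0 < e)%N -> ~~ (p %| e)%N ->
  moebius (p * e) = - moebius e.
Proof.
move=> pp e0 pe; have p0 := prime_gt0 pp.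
have pNe : p \notin primes e by rewrite mem_primes pp e0.
rewrite /moebius (perm_big (p :: primes e)) /=; last first.
  apply: uniq_perm; rewrite ?primes_uniq //= ?pNe ?primes_uniq // => q.
  by rewrite primesM // primes_prime // !inE.
rewrite big_cons lognM // logn_prime // eqxx (_ : logn p e = 0%N); last first.
  by apply/eqP; rewrite -leqn0 leqNgt logn_gt0.
rewrite mulN1r; congr (- _); apply: eq_big_seq => q qe.
rewrite lognM // logn_prime // [q == p]negbTE //.
by apply: contraNneq pNe => <-.
Qed.

Lemma moebius_square_mul p e : prime p -> (0 < e)%N -> (p %| e)%N ->
  moebius (p * e) = 0.
Proof.
move=> pp e0 pe; have p0 := prime_gt0 pp.
rewrite /moebius (big_rem p) /=; last by rewrite primesM // primes_prime // inE eqxx.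
rewrite lognM // logn_prime // eqxx ifF ?mul0r //.
have : (0 < logn p e)%N by rewrite logn_gt0 mem_primes pp e0.
by case: (logn p e).
Qed.

(** Take a prime p dividing n = p m. The divisors of n that are multiples of p are the p e with e
    dividing m: those with p dividing e contribute 0, the others contribute - mu(e). The latter
    cancel the divisors of n prime to p, which are exactly the divisors of m prime to p. *)
Lemma sum_moebius n : (0 < n)%N ->
  \sum_(d <- divisors n) moebius d = (n == 1%N)%:R.
Proof.
move=> n0; have [->|n1] := eqVneq n 1%N; first by rewrite big_seq1 moebius1.
have n1' : (1 < n)%N by case: n n0 n1 => [|[]].
set p := pdiv n; have pp : prime p by exact: pdiv_prime.
have p0 := prime_gt0 pp.
have [m nE] : exists m, n = (p * m)%N.
  by exists (n %/ p)%N; rewrite mulnC divnK // pdiv_dvd.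
have m0 : (0 < m)%N by move: n0; rewrite nE muln_gt0 => /andP[].
rewrite (bigID (fun d => p %| d)%N) /= -[in X in X + _]big_filter.
rewrite (perm_big [seq (p * e)%N | e <- divisors m]) /=; last first.
  apply: uniq_perm; rewrite ?filter_uniq ?divisors_uniq //.
    by rewrite map_inj_uniq ?divisors_uniq // => x y /eqP; rewrite eqn_pmul2l // => /eqP.
  move=> d; rewrite mem_filter -dvdn_divisors //; apply/andP/mapP => [[pd dn]|[e]].
    exists (d %/ p)%N; last by rewrite mulnC divnK.
    by rewrite -dvdn_divisors // -(dvdn_pmul2l p0) [(p * (_ %/ _))%N]mulnC divnK // -nE.
  by rewrite -dvdn_divisors // nE => em ->; rewrite dvdn_mulr // dvdn_pmul2l.
rewrite big_map (bigID (fun d => p %| d)%N) /= big1_seq; last first.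
  move=> e /andP[pe em]; apply: moebius_square_mul => //.
  by move: em; rewrite -dvdn_divisors // => /dvdn_gt0; apply.
rewrite add0r big_seq_cond.
under eq_bigr => e /andP[em pe].
  rewrite moebius_prime_mul //; last first.
    by move: em; rewrite -dvdn_divisors // => /dvdn_gt0; apply.
  over.
rewrite -big_seq_cond sumrN addrC; apply/eqP; rewrite subr_eq0; apply/eqP.
rewrite -[LHS]big_filter -[RHS]big_filter; apply: perm_big.
apply: uniq_perm; rewrite ?filter_uniq ?divisors_uniq // => d.
rewrite !mem_filter -!dvdn_divisors //; case: (boolP (p %| d)%N) => //= pd.
by rewrite nE Gauss_dvdr // coprime_sym prime_coprime.
Qed.

(** Testing only the prime factors of n makes this a boolean; for positive k and n it agrees with
    the test over all primes. *)
Definition kfree (k n : nat) : bool := ~~ has (fun p => p ^ k %| n)%N (primes n).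

Lemma kfreeP k n : (0 < k)%N -> (0 < n)%N ->
  reflect (forall p, prime p -> ~~ (p ^ k %| n)%N) (kfree k n).
Proof.
move=> k0 n0; apply: (iffP hasPn) => [h p pp|h p]; last first.
  by rewrite mem_primes => /andP[/h].
apply/negP => pn; have := h p; rewrite pn mem_primes pp n0 /=.
by rewrite (dvdn_trans _ pn) ?dvdn_exp // => /(_ isT).
Qed.

(* The witness is the largest [e] with [e ^ k %| n]. *)
Lemma kth_power_divisors k n : (0 < k)%N -> (0 < n)%N ->
  exists2 e, (0 < e)%N & forall d, (d ^ k %| n)%N = (d %| e)%N.
Proof.
move=> k0 n0.
have ex : exists e, (e ^ k %| n)%N by exists 1%N; rewrite exp1n dvd1n.
have bd e : (e ^ k %| n)%N -> (e <= n)%N.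
  move=> /(dvdn_leq n0); apply: leq_trans.
  by case: e => // e; rewrite -[X in (X <= _)%N]expn1 leq_pexp2l.
case: (ex_maxnP ex bd) => e ekn emax.
have e0 : (0 < e)%N by apply: emax; rewrite exp1n dvd1n.
exists e => // d; apply/idP/idP => [dkn|de]; last first.
  by apply: dvdn_trans ekn; rewrite dvdn_exp2r.
have d0 : (0 < d)%N.
  by rewrite lt0n; apply: contraTneq dkn => ->; rewrite exp0n // dvd0n -lt0n.
pose g := gcdn d e; have g0 : (0 < g)%N by rewrite gcdn_gt0 d0.
have [d' dE] : exists d', d = (d' * g)%N.
  by exists (d %/ g)%N; rewrite divnK // dvdn_gcdl.
have [e' eE] : exists e', e = (e' * g)%N.
  by exists (e %/ g)%N; rewrite divnK // dvdn_gcdr.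
have cop : coprime d' e'.
  rewrite /coprime -(eqn_pmul2r g0) mul1n muln_gcdl -dE -eE; exact/eqP.
have [n' nE] : exists n', n = (g ^ k * n')%N.
  exists (n %/ g ^ k)%N; rewrite mulnC divnK //.
  by apply: dvdn_trans ekn; rewrite dvdn_exp2r // dvdn_gcdr.
have gk0 : (0 < g ^ k)%N by rewrite expn_gt0 g0.
(* Here d' e' g is the lcm of d and e. Its k-th power divides n because d'^k and e'^k are coprime
   divisors of n / g^k. Maximality of e then gives d' e <= e, hence d' = 1 and d divides e. *)
have : ((d' * e' * g) ^ k %| n)%N.
  rewrite nE expnMn mulnC dvdn_pmul2l // expnMn Gauss_dvd; last first.
    by rewrite coprimeXl // coprimeXr.
  rewrite -(dvdn_pmul2l gk0) -nE mulnC -expnMn -dE dkn.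
  by rewrite -(dvdn_pmul2l gk0) -nE mulnC -expnMn -eE ekn.
move=> /emax; rewrite -mulnA -eE => h.
have -> : d = (1 * g)%N; last by rewrite mul1n dvdn_gcdr.
rewrite dE; congr (_ * _)%N; apply/eqP; rewrite eqn_leq.
rewrite -(leq_pmul2r e0) mul1n h /=.
by move: d0; rewrite dE muln_gt0 => /andP[].
Qed.

(** For the e of [kth_power_divisors], the sum runs over the divisors of e, and n is k-free exactly
    when e = 1, so [sum_moebius] applies. The bound on n ensures that no d with d^k dividing n
    exceeds D. *)
Lemma kfree_moebius k n D : (0 < k)%N -> (0 < n)%N -> (n < D.+1 ^ k)%N ->
  (kfree k n)%:R = \sum_(1 <= d < D.+1 | (d ^ k %| n)%N) moebius d.
Proof.
move=> k0 n0 nD; have [e e0 he] := kth_power_divisors k0 n0.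
have -> : kfree k n = (e == 1%N).
  apply/(kfreeP k0 n0)/eqP => [h|e1 p pp]; last first.
    by rewrite he e1 dvdn1; case: p pp => [|[]].
  apply/eqP; rewrite eqn_leq e0 andbT leqNgt; apply/negP => e1.
  by have := h _ (pdiv_prime e1); rewrite he pdiv_dvd.
rewrite -sum_moebius // -[RHS]big_filter; apply: perm_big; apply: uniq_perm.
- exact: divisors_uniq.
- by rewrite filter_uniq // iota_uniq.
move=> d; rewrite -dvdn_divisors // mem_filter he mem_index_iota.
case: (boolP (d %| e)%N) => //= de; rewrite (dvdn_gt0 e0 de) /=.
rewrite ltnS; apply/esym; move: de; rewrite -he => /(dvdn_leq n0) h.
by have := leq_ltn_trans h nD; rewrite ltn_exp2r // ltnS.
Qed.

Lemma big_nat_dvd (V : nmodType) (d N : nat) (F : nat -> V) : (0 < d)%N ->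
  \sum_(1 <= n < N.+1 | (d %| n)%N) F n = \sum_(1 <= e < (N %/ d).+1) F (d * e)%N.
Proof.
move=> d0; elim: N => [|N IH]; first by rewrite div0n !big_geq.
rewrite big_mkcond big_nat_recr //= -big_mkcond IH divnS //.
case: ifPn => dN; last by rewrite addr0.
have E : (N.+1 %/ d = (N %/ d).+1)%N by rewrite divnS // dN.
by rewrite add1n [RHS]big_nat_recr //= -E [(d * _)%N]mulnC divnK.
Qed.

Definition kfree_count (k N : nat) : nat := \sum_(1 <= n < N.+1) kfree k n.

(** Sum [kfree_moebius] over n and exchange the sums: exactly floor(N / d^k) integers up to N are
    multiples of d^k. *)
Lemma kfree_countE k N D : (0 < k)%N -> (N < D.+1 ^ k)%N ->
  (kfree_count k N)%:Z = \sum_(1 <= d < D.+1) moebius d * (N %/ d ^ k)%N%:Z.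
Proof.
move=> k0 ND.
rewrite /kfree_count -[LHS]natz natr_sum.
under eq_big_nat => n /andP[n0 nN].
  rewrite (@kfree_moebius k n D) //; last exact: leq_ltn_trans ND.
  rewrite big_mkcond; over.
rewrite exchange_big /=; apply: eq_big_nat => d /andP[d0 _].
rewrite -big_mkcond /= big_nat_dvd ?expn_gt0 ?d0 // sumr_const_nat subn1 /=.
by rewrite -mulr_natr natz.
Qed.

(** * Counting k-free integers *)

Section ZetaPartialSums.
Context {R : realType} (k : nat).

(** The exponent is written k + 2 so that convergence is built in. *)
Definition zeta_sum (n : nat) : R := \sum_(1 <= d < n.+1) (d%:R ^+ k.+2)^-1.

Lemma zeta_sumS n : zeta_sum n.+1 = zeta_sum n + (n.+1%:R ^+ k.+2)^-1.
Proof. by rewrite /zeta_sum big_nat_recr. Qed.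

Lemma zeta_sum_nd : {homo zeta_sum : m n / (m <= n)%N >-> m <= n}.
Proof.
apply: homo_leq => [//|y x z|n]; first exact: le_trans.
by rewrite zeta_sumS lerDl invr_ge0 exprn_ge0.
Qed.

(** The first term is at most 1/(D+1)^(k+1). Each later term 1/(a+1)^(k+2) is at most (1/a -
    1/(a+1)) / (D+1)^k, and these telescope to at most another 1/(D+1)^(k+1); hence the constant
    2. *)
Lemma zeta_sum_tail D n : (D <= n)%N ->
  zeta_sum n - zeta_sum D <= 2 / D.+1%:R ^+ k.+1.
Proof.
have D0 : 0 < D.+1%:R :> R by rewrite ltr0n.
have key L : zeta_sum (D.+1 + L) - zeta_sum D <=
    (D.+1%:R ^+ k)^-1 * (2 / D.+1%:R - (D.+1 + L)%:R^-1).
  elim: L => [|L IH].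
    rewrite addn0 zeta_sumS addrAC subrr add0r [2]mulrSr mulrDl mul1r addrK.
    rewrite -addn2 exprD invfM ler_wpM2l ?invr_ge0 ?exprn_ge0 //.
    by rewrite expr2 invfM ler_piMl ?invr_ge0 // invf_le1 // ler1n.
  rewrite addnS zeta_sumS; set a := (D.+1 + L)%N in IH *.
  have a0 : 0 < a%:R :> R by rewrite ltr0n.
  have a1 : 0 < a.+1%:R :> R by rewrite ltr0n.
  have : (a.+1%:R ^+ k.+2)^-1 <= (D.+1%:R ^+ k)^-1 * (a%:R^-1 - a.+1%:R^-1) :> R.
    rewrite -addn2 exprD invfM; apply: ler_pM; rewrite ?invr_ge0 ?exprn_ge0 //.
      rewrite lef_pV2 ?posrE ?exprn_gt0 // lerXn2r ?nnegrE ?ler0n // ler_nat.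
      by rewrite leqW // leq_addr.
    have -> : a%:R^-1 - a.+1%:R^-1 = (a%:R * a.+1%:R)^-1 :> R.
      by rewrite -[a.+1%:R]natr1; field; rewrite natr1 !pnatr_eq0.
    by rewrite lef_pV2 ?posrE ?mulr_gt0 // expr2 ler_pM2r // ler_nat.
  move=> h; rewrite addrAC; apply: le_trans (lerD IH h) _.
  by rewrite -mulrDr addrA subrK.
rewrite leq_eqVlt => /predU1P[<-|Dn].
  by rewrite subrr divr_ge0 // exprn_ge0.
rewrite -(subnKC Dn); apply: le_trans (key _) _.
rewrite [in leRHS]exprS invfM [leRHS]mulrA [leRHS]mulrC.
rewrite ler_wpM2l ?invr_ge0 ?exprn_ge0 //.
by rewrite gerBl invr_ge0.
Qed.

Lemma series_riemannR n : series (riemannR k.+2%:R) n = zeta_sum n.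
Proof.
rewrite /zeta_sum big_add1 /series /=; apply: eq_bigr => i _.
by rewrite /riemannR powR_mulrn ?ler0n.
Qed.

Lemma cvg_zeta_sum : zeta_sum @ \oo --> zeta k.+2%:R.
Proof.
have sE : series (riemannR k.+2%:R) = zeta_sum :> (R ^nat).
  by apply/funext => n; rewrite series_riemannR.
rewrite /zeta sE; apply: (nondecreasing_is_cvgn zeta_sum_nd).
(* The bound 2 is the tail estimate at D = 0, where the partial sum is empty. *)
exists 2 => _ [n _ <-]; have := zeta_sum_tail (leq0n n).
by rewrite {2}/zeta_sum big_geq // subr0 expr1n divr1.
Qed.

Lemma zeta_sum_le n : zeta_sum n <= zeta k.+2%:R.
Proof.
apply: (cvgr_to_ge cvg_zeta_sum); exists n => // m /= nm; exact: zeta_sum_nd.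
Qed.

Lemma zeta_le_tail n : zeta k.+2%:R <= zeta_sum n + 2 / n.+1%:R ^+ k.+1.
Proof.
apply: (cvgr_to_le cvg_zeta_sum); exists n => // m /= nm.
by rewrite -lerBlDl zeta_sum_tail.
Qed.

Lemma zeta_ge1 : 1 <= zeta k.+2%:R :> R.
Proof.
by apply: le_trans (zeta_sum_le 1); rewrite /zeta_sum big_nat1 expr1n invr1.
Qed.

(** * Partial sums of mu(d)/d^(k+2) and their limit 1/zeta(k+2) *)

Definition moebius_sum (D : nat) : R :=
  \sum_(1 <= d < D.+1) (moebius d)%:~R / d%:R ^+ k.+2.

Lemma moebius_normr_le1 n : `|(moebius n)%:~R| <= 1 :> R.
Proof. by rewrite -intr_norm lerz1 moebius_norm_le1. Qed.

Lemma moebius_sum_tail D n : (D <= n)%N ->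
  `|moebius_sum n - moebius_sum D| <= zeta_sum n - zeta_sum D.
Proof.
elim: n => [|n IH]; first by rewrite leqn0 => /eqP ->; rewrite !subrr normr0.
rewrite leq_eqVlt => /predU1P[<-|]; first by rewrite !subrr normr0.
rewrite ltnS => /IH h; rewrite zeta_sumS /moebius_sum big_nat_recr //=.
rewrite addrAC [leRHS]addrAC (le_trans (ler_normD _ _)) // lerD //.
rewrite normrM (ger0_norm (x := _^-1)) ?invr_ge0 ?exprn_ge0 //.
by rewrite ler_piMl ?moebius_normr_le1 // invr_ge0 exprn_ge0.
Qed.

(** Writing n = d e regroups the double sum as the sum over n <= D of (sum over d dividing n of
    mu(d)) / n^(k+2), in which only n = 1 survives. *)
Lemma moebius_zeta_sum D : (0 < D)%N ->
  \sum_(1 <= d < D.+1) (moebius d)%:~R / d%:R ^+ k.+2 * zeta_sum (D %/ d)%N = 1.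
Proof.
move=> D0.
transitivity (\sum_(1 <= n < D.+1)
    (\sum_(d <- divisors n) (moebius d)%:~R) / n%:R ^+ k.+2 : R); last first.
  rewrite big_ltn // [X in _ + X]big_nat_cond [X in _ + X]big1 => [|n /andP[/andP[n1 _] _]].
    by rewrite addr0 big_seq1 moebius1 expr1n invr1 mulr1.
  rewrite -rmorph_sum /= sum_moebius ?(ltn_trans _ n1) //.
  by case: n n1 => [|[]] // n _; rewrite mul0r.
have hn n : (1 <= n < D.+1)%N ->
    (\sum_(d <- divisors n) (moebius d)%:~R) / n%:R ^+ k.+2 =
    \sum_(1 <= d < D.+1) (if (d %| n)%N then (moebius d)%:~R / n%:R ^+ k.+2 else 0) :> R.
  move=> /andP[n0 nD]; rewrite mulr_suml -big_mkcond -[RHS]big_filter.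
  apply: perm_big; apply: uniq_perm; rewrite ?divisors_uniq ?filter_uniq ?iota_uniq //.
  move=> d; rewrite mem_filter mem_index_iota -dvdn_divisors //.
  case: (boolP (d %| n)%N) => //= dn; rewrite (dvdn_gt0 n0 dn) /=.
  by rewrite (leq_ltn_trans (dvdn_leq n0 dn)).
rewrite [RHS](eq_big_nat _ _ hn) exchange_big /=.
apply: eq_big_nat => d /andP[d0 _]; rewrite -big_mkcond /= big_nat_dvd //.
rewrite mulr_sumr; apply: eq_bigr => e _.
by rewrite natrM exprMn [(_ * e%:R ^+ _)^-1]invfM mulrA.
Qed.

(** Subtract [moebius_zeta_sum]. With q = floor(D/d), the d-th term is mu(d)/d^(k+2) times the zeta
    tail beyond q, which is at most 2/(q+1) <= 2 d/D; as 1/d^(k+2) <= 1/d^2, the term is at most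
    2/(D d). The bound is left as a mean of reciprocals, to which Cesaro's theorem applies. *)
Lemma moebius_sum_zeta_dist D : (0 < D)%N ->
  `|moebius_sum D * zeta k.+2%:R - 1| <=
  2 * (D%:R^-1 * \sum_(1 <= d < D.+1) d%:R^-1).
Proof.
move=> D0; rewrite -{2}(moebius_zeta_sum D0) /moebius_sum mulr_suml -sumrB.
apply: le_trans (ler_norm_sum _ _ _) _; rewrite !mulr_sumr !big_seq.
apply: ler_sum => d; rewrite mem_index_iota => /andP[d0 dD].
rewrite -mulrBr; set t := zeta _ - _.
have t0 : 0 <= t by rewrite subr_ge0 zeta_sum_le.
have dp : 0 < d%:R :> R by rewrite ltr0n.
have Dp : 0 < D%:R :> R by rewrite ltr0n.
set q := (D %/ d)%N in t t0 *.
have tq : t <= 2 / q.+1%:R.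
  have := zeta_le_tail q; rewrite -lerBlDl => /le_trans; apply.
  rewrite ler_pM2l // lef_pV2 ?posrE ?exprn_gt0 ?ltr0n //.
  by rewrite exprS ler_pMr ?ltr0n // exprn_ege1 // ler1n.
have qd : D%:R <= q.+1%:R * d%:R :> R.
  by rewrite -natrM ler_nat ltnW // -ltn_divLR.
rewrite 2!normrM (ger0_norm t0) (ger0_norm (x := _^-1)) ?invr_ge0 ?exprn_ge0 //.
have -> : 2 * (D%:R^-1 / d%:R) = (d%:R ^+ 2)^-1 * (2 * (d%:R / D%:R)) :> R.
  by field; rewrite !lt0r_neq0.
apply: ler_pM => //.
  rewrite -[leRHS]mul1r; apply: ler_pM => //.
  exact: moebius_normr_le1.
  rewrite lef_pV2 ?posrE ?exprn_gt0 // -[k.+2]addn2 exprD ler_peMl ?exprn_ge0 //.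
  by rewrite exprn_ege1 // ler1n.
apply: le_trans tq _; rewrite ler_pM2l //.
by rewrite ler_pdivlMr // mulrC ler_pdivrMr ?ltr0n // mulrC.
Qed.

(** Compare the sum up to D with a longer one: the tail costs at most 2/(D+1)^(k+1), and the longer
    sum times zeta tends to 1. Passing to the limit in this inequality and dividing by zeta gives a
    bound with no error term left. *)
Lemma moebius_sum_inv_zeta D :
  `|moebius_sum D - (zeta k.+2%:R)^-1| <= 2 / D.+1%:R ^+ k.+1.
Proof.
have z0 : 0 < zeta k.+2%:R :> R by rewrite (lt_le_trans _ zeta_ge1).
have -> : moebius_sum D - (zeta k.+2%:R)^-1 =
    (moebius_sum D * zeta k.+2%:R - 1) / zeta k.+2%:R.
  by rewrite mulrBl mulfK ?mul1r ?gt_eqF.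
rewrite normrM normfV (ger0_norm (ltW z0)) ler_pdivrMr //.
have H : (fun n => 2 / D.+1%:R ^+ k.+1 * zeta k.+2%:R + 2 * arithmetic_mean harmonic n)
    @ \oo --> (2 / D.+1%:R ^+ k.+1 * zeta k.+2%:R + 2 * 0 : R).
  apply: cvgD; first exact: cvg_cst.
  by apply: cvgM; [exact: cvg_cst|exact: cesaro cvg_harmonic].
rewrite mulr0 addr0 in H; apply: (cvgr_to_ge H); exists D => // n /= Dn.
(* The mean of index n averages the n + 1 terms 1, ..., 1/(n+1), hence the cutoff n + 1. *)
have := @moebius_sum_zeta_dist n.+1 isT.
rewrite big_add1 /= => h.
have := moebius_sum_tail (leqW Dn) => /le_trans /(_ (zeta_sum_tail (leqW Dn))) h2.
rewrite -(subrK (moebius_sum n.+1 * zeta k.+2%:R) (moebius_sum D * _)) -addrA.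
apply: le_trans (ler_normD _ _) _; apply: lerD h.
by rewrite distrC -mulrBl normrM (ger0_norm (ltW z0)) ler_pM2r.
Qed.

(** Let N = floor(Y) and D = floor(s), so that N < (D+1)^(k+2). Removing the floors of N / d^(k+2)
    costs at most D <= s ([e1]), completing the Möbius series at most 2 N/(D+1)^(k+1) <= 2 (s+1)
    ([e2]), and replacing N by Y at most 1 ([e3]). *)
Lemma kfree_count_natural (Y : R) (s : R) : 0 <= s -> s ^+ k.+2 = Y ->
  `|(kfree_count k.+2 (Num.truncn Y))%:R - Y / zeta k.+2%:R| <= 3 * s + 3.
Proof.
move=> s0 sY; have Y0 : 0 <= Y by rewrite -sY exprn_ge0.
set N := Num.truncn Y; set D := Num.truncn s.
have /andP[NY YN] := truncn_itv Y0; have /andP[Ds sD] := truncn_itv s0.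
have z0 : 0 < zeta k.+2%:R :> R by rewrite (lt_le_trans _ zeta_ge1).
have YD : Y < D.+1%:R ^+ k.+2 by rewrite -sY ltrXn2r ?nnegrE // ler0n.
have ND : (N < D.+1 ^ k.+2)%N.
  by rewrite -(ltr_nat R) natrX (le_lt_trans NY).
have e1 : `|(kfree_count k.+2 N)%:R - N%:R * moebius_sum D| <= D%:R.
  rewrite -[(kfree_count _ _)%:R]/((kfree_count k.+2 N)%:Z%:~R) (kfree_countE _ ND) //.
  rewrite rmorph_sum /moebius_sum mulr_sumr -sumrB.
  apply: le_trans (ler_norm_sum _ _ _) _.
  apply: (@le_trans _ _ (\sum_(1 <= d < D.+1) 1)); last first.
    by rewrite sumr_const_nat subn1.
  rewrite !big_seq; apply: ler_sum => d; rewrite mem_index_iota => /andP[d0 _].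
  have dk0 : (0 < d ^ k.+2)%N by rewrite expn_gt0 d0.
  have dk : 0 < (d ^ k.+2)%N%:R :> R by rewrite ltr0n.
  rewrite rmorphM /= -pmulrn mulrCA -mulrBr normrM -[leRHS]mulr1.
  apply: ler_pM => //; first exact: moebius_normr_le1.
  rewrite -natrX distrC ger0_norm.
    rewrite lerBlDl natr1 ler_pdivrMr // -natrM ler_nat ltnW //.
    by rewrite -ltn_divLR // ltnS.
  by rewrite subr_ge0 ler_pdivlMr // -natrM ler_nat leq_trunc_div.
have e2 : `|N%:R * moebius_sum D - N%:R / zeta k.+2%:R| <= 2 * D.+1%:R.
  rewrite -mulrBr normrM (ger0_norm (ler0n _ _)).
  apply: le_trans (ler_wpM2l (ler0n _ _) (moebius_sum_inv_zeta D)) _.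
  rewrite mulrCA ler_pM2l // ler_pdivrMr ?exprn_gt0 ?ltr0n // -exprS.
  exact: le_trans NY (ltW YD).
have e3 : `|N%:R / zeta k.+2%:R - Y / zeta k.+2%:R| <= 1.
  rewrite -mulrBl normrM -[leRHS]mulr1; apply: ler_pM => //.
    rewrite distrC ger0_norm ?subr_ge0 // lerBlDl natr1 ltW //.
  by rewrite ger0_norm ?invr_ge0 ?(ltW z0) // invf_le1 // zeta_ge1.
have -> : 3 * s + 3 = s + 2 * (s + 1) + 1 by ring.
apply: le_trans (ler_distD (N%:R / zeta k.+2%:R) _ _) _; apply: lerD e3.
apply: le_trans (ler_distD (N%:R * moebius_sum D) _ _) _; apply: lerD.
  exact: le_trans e1 Ds.
by apply: le_trans e2 _; rewrite ler_pM2l // -natr1 lerD2r.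
Qed.

End ZetaPartialSums.

(** * Valuations on the rationals *)

Section RationalValuation.
Implicit Types (p : nat) (x y a s : rat).

(** The fraction need not be reduced: compare valuations in the integer identity
    [numq x * n = m * denq x]. *)
Lemma ordq_frac p (m n : int) : m != 0 -> n != 0 ->
  ordq p (m%:~R / n%:~R) = (logn p `|m|)%:Z - (logn p `|n|)%:Z.
Proof.
move=> m0 n0; set x := (_ / _ : rat).
have x0 : numq x != 0 by rewrite numq_eq0 mulf_neq0 ?invr_eq0 ?intq_eq0.
have d0 := denq_neq0 x.
have E : (numq x * n)%:~R = (m * denq x)%:~R :> rat.
  rewrite !intrM; have dq : (denq x)%:~R != 0 :> rat by rewrite intq_eq0.
  have nq : n%:~R != 0 :> rat by rewrite intq_eq0.
  rewrite -[(numq x)%:~R](mulfVK dq) divq_num_den /x mulrAC; congr (_ * _).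
  by rewrite mulfVK.
have := congr1 (fun z => logn p `|z|%N) (intr_inj E).
rewrite !abszM !lognM ?absz_gt0 // /ordq; lia.
Qed.

Lemma ordqM p x y : x != 0 -> y != 0 -> ordq p (x * y) = ordq p x + ordq p y.
Proof.
move=> x0 y0; rewrite -{1}[x]divq_num_den -{1}[y]divq_num_den mulf_div -!intrM.
rewrite ordq_frac ?mulf_neq0 ?denq_neq0 ?numq_eq0 // !abszM.
by rewrite !lognM ?absz_gt0 ?denq_neq0 ?numq_eq0 // /ordq; lia.
Qed.

Lemma ordq1 p : ordq p 1 = 0.
Proof. by rewrite /ordq (numq_int 1) (denq_int 1) !logn1. Qed.

Lemma ordqV p x : x != 0 -> ordq p x^-1 = - ordq p x.
Proof.
move=> x0; have : ordq p (x * x^-1) = 0 by rewrite mulfV // ordq1.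
by rewrite ordqM ?invr_eq0 //; lia.
Qed.

Lemma ordqX p x n : x != 0 -> ordq p (x ^+ n) = ordq p x *+ n.
Proof.
move=> x0; elim: n => [|n IH]; first by rewrite expr0 ordq1.
by rewrite exprS ordqM ?expf_neq0 // IH mulrS.
Qed.

Lemma ordq_primeXz p q (e : int) : prime q ->
  ordq p (q%:R ^ e) = e * (p == q)%:R.
Proof.
move=> pq; have q0 : q%:R != 0 :> rat by rewrite pnatr_eq0 -lt0n prime_gt0.
have oq : ordq p q%:R = (p == q)%:R.
  by rewrite /ordq pmulrn numq_int denq_int logn1 subr0 /= logn_prime //; case: (p == q).
case: e => n; first by rewrite -exprnP ordqX // oq -[Posz n]natz mulr_natl.
by rewrite NegzE -exprnN ordqV ?expf_neq0 // ordqX // oq mulNr -[Posz n.+1]natz mulr_natl.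
Qed.

(** A prime dividing the reduced denominator does not divide the numerator, so its valuation is
    negative. *)
Lemma Qint_ordqP x : x != 0 ->
  reflect (forall p, prime p -> 0 <= ordq p x) (x \is a Num.int).
Proof.
move=> x0; apply: (iffP idP) => [|h].
  by rewrite Qint_def => /eqP dx p pp; rewrite /ordq dx logn1 subr0.
rewrite Qint_def -[denq x]gez0_abs ?denq_ge0 //; apply/eqP; congr Posz.
apply/eqP; rewrite eqn_leq absz_gt0 denq_neq0 andbT leqNgt; apply/negP => d1.
have pp := pdiv_prime d1; have := h _ pp; set p := pdiv _ in pp *.
have pd : (p %| `|denq x|)%N by exact: pdiv_dvd.
rewrite /ordq logn_coprime; last first.
  by rewrite (coprime_dvdl pd) // coprime_sym coprime_num_den.
have : (0 < logn p `|denq x|)%N by rewrite logn_gt0 mem_primes pp pd absz_gt0 denq_neq0.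
lia.
Qed.

Lemma Nq_prod a : a != 0 -> exists2 M : nat,
  Nq a = \prod_(0 <= q < M | prime q) (q%:R : rat) ^ alpha_exp q a &
  forall q, (M <= q)%N -> alpha_exp q a = 0.
Proof.
move=> a0; pose M := (`|numq a| + `|denq a|).+1.
have hM q : (M <= q)%N -> alpha_exp q a = 0.
  move=> Mq; have h (n : int) : n != 0 -> (`|n| < q)%N -> logn q `|n| = 0%N.
    move=> n0 nq; apply/eqP; rewrite -leqn0 leqNgt logn_gt0 mem_primes !negb_and.
    by rewrite (gtnNdvd _ nq) ?absz_gt0 // !orbT.
  rewrite /alpha_exp /ordq !h ?denq_neq0 ?numq_eq0 //; last 2 first.
  - by apply: leq_trans Mq; rewrite ltnS leq_addl.
  - by apply: leq_trans Mq; rewrite ltnS leq_addr.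
exists M => //; rewrite /Nq /index_iota subn0; apply/esym/bigfs; first exact: iota_uniq.
by move=> q _; rewrite mem_iota add0n /= -leqNgt => /hM ->; rewrite expr0z.
Qed.

Lemma Nq_gt0 a : a != 0 -> 0 < Nq a.
Proof.
move=> a0; have [M -> _] := Nq_prod a0; apply: prodr_gt0 => q pq.
by rewrite exprz_gt0 // ltr0n prime_gt0.
Qed.

Lemma ordq_Nq p a : prime p -> a != 0 -> ordq p (Nq a) = alpha_exp p a.
Proof.
move=> pp a0; have [M -> hM] := Nq_prod a0.
have {hM} : (M <= p)%N -> alpha_exp p a = 0 by exact: hM.
have : forall L, ordq p (\prod_(0 <= q < L | prime q) (q%:R : rat) ^ alpha_exp q a)
    = alpha_exp p a * (p < L)%N%:R.
  elim=> [|L IH]; first by rewrite big_geq // ordq1 mulr0.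
  rewrite big_mkcond big_nat_recr //= -big_mkcond /=.
  case: ifP => pL; last first.
    rewrite mulr1 IH ltnS [(p <= L)%N]leq_eqVlt; case: eqP => // E.
    by rewrite E pL in pp.
  have L0 : L%:R != 0 :> rat by rewrite pnatr_eq0 -lt0n prime_gt0.
  have P0 : \prod_(0 <= q < L | prime q) (q%:R : rat) ^ alpha_exp q a != 0.
    rewrite gt_eqF //; apply: prodr_gt0 => q pq.
    by rewrite exprz_gt0 // ltr0n prime_gt0.
  rewrite ordqM // ?expfz_neq0 // ordq_primeXz // IH.
  rewrite ltnS [(p <= L)%N]leq_eqVlt; have [->|] := eqVneq p L.
    by rewrite ltnn mulr0 add0r.
  by rewrite mulr0 addr0.
move=> -> h; case: (ltnP p M) => [|/h ->]; by rewrite ?mulr1 ?mul0r.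
Qed.

(** The two cases of the definition together give the maximum of ceil(ord/2) and ceil(ord/3): for
    ord >= 0 the condition ord <= 2t implies ord <= 3t, and for ord < 0 the implication is reversed.
    The two conditions become the integrality of s^2/a and of s^3/a. *)
Lemma alpha_exp_le p a (t : int) :
  (alpha_exp p a <= t) = (ordq p a <= t *+ 2) && (ordq p a <= t *+ 3).
Proof.
rewrite /alpha_exp; case: (lerP 0 (ordq p a)) => o.
  rewrite ceil_le_int ler_pdivrMr // -[2]/(2%:~R) -intrM ler_int.
  apply/idP/andP; lia.
rewrite ceil_le_int ler_pdivrMr // -[3]/(3%:~R) -intrM ler_int.
apply/idP/andP; lia.
Qed.

(* A point of [B ^ 2 = a * A ^ 3] with [s = B / A] is [(s ^ 2 / a, s ^ 3 / a)]:
   the integral points are those with [s] a multiple of [Nq a]. *)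
Lemma Qint_Nq a s : a != 0 -> s != 0 ->
  (s / Nq a \is a Num.int) = (s ^+ 2 / a \is a Num.int) && (s ^+ 3 / a \is a Num.int).
Proof.
move=> a0 s0; have N0 : Nq a != 0 by rewrite gt_eqF // Nq_gt0.
have h n : s ^+ n / a != 0 by rewrite mulf_neq0 ?expf_neq0 ?invr_eq0.
have E n p : ordq p (s ^+ n / a) = ordq p s *+ n - ordq p a.
  by rewrite ordqM ?invr_eq0 ?expf_neq0 // ordqX // ordqV.
have EN p : prime p -> ordq p (s / Nq a) = ordq p s - alpha_exp p a.
  by move=> pp; rewrite ordqM ?invr_eq0 // ordqV // ordq_Nq.
apply/(Qint_ordqP _)/andP => [|H|[/(Qint_ordqP (h _)) h2 /(Qint_ordqP (h _)) h3] p pp].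
- by rewrite mulf_neq0 ?invr_eq0.
- split; apply/(Qint_ordqP (h _)) => p pp; have := H p pp;
    by rewrite EN // E !subr_ge0 alpha_exp_le => /andP[].
- rewrite EN // subr_ge0 alpha_exp_le; move: (h2 p pp) (h3 p pp).
  by rewrite !E !subr_ge0 => -> ->.
Qed.

End RationalValuation.

(** * Counting families of curves *)

(** Each admissible n in [1, N] accounts for the two distinct points f(n) and f(-n). As [counting]
    is infinite on infinite sets, S is first listed by a duplicate-free sequence. *)
Lemma counting_image_symmetric (T : choiceType) (R : realType) (f : int -> T)
    (P : pred nat) (N : nat) (S : set T) : injective f ->
  (forall E, S E <-> exists n : int, [/\ n != 0, (`|n| <= N)%N, P `|n|%N & E = f n]) ->
  @counting T R S = (2 * \sum_(1 <= n < N.+1) P n)%N%:R%:E.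
Proof.
move=> finj hS.
pose r := [seq i <- index_iota 1 N.+1 | P i].
pose s := [seq f n | n <- [seq Posz i | i <- r] ++ [seq - Posz i | i <- r]].
have ur : uniq r by rewrite filter_uniq // iota_uniq.
have us : uniq s.
  rewrite map_inj_uniq // cat_uniq !map_inj_uniq ?ur //=; last 2 first.
  - by move=> x y /oppr_inj [].
  - by move=> x y [].
  rewrite andbT; apply/hasPn => _ /mapP[i ir ->]; apply/mapP => -[i' i'r].
  move: ir; rewrite mem_filter mem_index_iota => /and3P[_ i0 _]; lia.
have -> : S = [set` s].
  apply/seteqP; split => E /=.
    move=> /hS[n [n0 nN Pn ->]]; apply: map_f; rewrite mem_cat.
    have nr : `|n|%N \in r by rewrite mem_filter Pn mem_index_iota absz_gt0 n0.
    have [p|p] := leP 0 n; apply/orP; [left|right]; apply/mapP; exists `|n|%N => //; lia.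
  move=> /mapP[n]; rewrite mem_cat => /orP nr ->; apply/hS; exists n.
  case: nr => /mapP[i]; rewrite mem_filter mem_index_iota => /and3P[Pi i0 iN] ->.
    by split => //; lia.
  by rewrite abszN absz_nat; split => //; lia.
rewrite /counting asboolT; last exact: finite_seq.
have -> : [set` s] = [set` [fset x | x in s]%fset].
  by apply/seteqP; split => x /=; rewrite !inE.
rewrite set_fsetK card_fseq undup_id // size_map size_cat !size_map addnn -mul2n.
by rewrite size_filter -sum1_count big_mkcond; congr (_%:R%:E); congr (_ * _)%N;
  apply: eq_bigr => i _; case: (P i).
Qed.

(** * Counts for a family parametrised by the nonzero integers *)

Section CountFamily.
Context {R : realType} (j : rat) (alpha beta : R) (k : nat) (f : int -> curve).
Hypothesis f_inj : injective f.
Hypothesis f_with_j :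
  forall E, with_j all_curves j E <-> exists2 n, n != 0 & E = f n.
Hypothesis f_minimal :
  forall n, n != 0 -> (minimal_curves (f n) <-> kfree k.+2 `|n|).

Section FixedHeight.
Variables (X Y : R).
Hypothesis Y0 : 0 <= Y.
Hypothesis f_height :
  forall n, (height alpha beta (f n) <= X) = (`|n|%N%:R <= Y).

Lemma counting_all : @counting _ R (up_to_height alpha beta (with_j all_curves j) X)
  = (2 * Num.floor Y)%:~R%:E.
Proof.
rewrite (counting_image_symmetric (P := xpredT) (N := Num.truncn Y) R f_inj).
  rewrite sum_nat_const_nat subn1 /= muln1 truncn_floor Y0 pmulrn; congr (_%:~R%:E).
  have := floor_ge0 Y; rewrite Y0 => fY.
  by rewrite PoszM gez0_abs.
move=> E; split => [[/f_with_j[n n0 ->]]|[n [n0 nY _ ->]]].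
  by rewrite f_height -truncn_ge_nat // => nY; exists n.
by split; [apply/f_with_j; exists n|rewrite f_height -truncn_ge_nat].
Qed.

Lemma counting_minimal :
  @counting _ R (up_to_height alpha beta (with_j minimal_curves j) X)
  = (2 * kfree_count k.+2 (Num.truncn Y))%N%:R%:E.
Proof.
apply: (counting_image_symmetric (P := kfree k.+2) R f_inj) => E; split.
  move=> [[mE jE]]; have /f_with_j[n n0 EE] : with_j all_curves j E.
    exact: conj mE.1 jE.
  rewrite EE f_height -(truncn_ge_nat _ Y0) => nY; exists n.
  by split; [exact: n0|exact: nY|apply/(f_minimal n0); rewrite -EE|].
move=> [n [n0 nY Pn ->]].
have [_ jE] : with_j all_curves j (f n) by apply/f_with_j; exists n.
split; last by rewrite f_height -(truncn_ge_nat _ Y0); exact: nY.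
exact: conj ((f_minimal n0).2 Pn) jE.
Qed.

End FixedHeight.

(** The root of order k + 2 of Y(X) is a constant times X^(1/12), so [kfree_count_natural] yields
    the same error exponent for every k. *)
Lemma counting_minimal_asymptotic (c : R) (Y : R -> R) : 0 <= c ->
  (forall X, 1 < X -> Y X = c * (X `^ 12^-1) ^+ k.+2) ->
  (forall X n, 1 < X -> (height alpha beta (f n) <= X) = (`|n|%N%:R <= Y X)) ->
  exists C : R, forall X : R, 1 < X ->
   (`| @counting _ R (up_to_height alpha beta (with_j minimal_curves j) X)
       - (2 * (Y X / zeta k.+2%:R))%:E | <= (C * X `^ 12^-1)%:E)%E.
Proof.
move=> c0 hY hh; pose c' := c `^ k.+2%:R^-1.
have c'E : c' ^+ k.+2 = c.
  by rewrite -powR_mulrn ?powR_ge0 // -powRrM mulVf ?pnatr_eq0 // powRr1.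
(* Counting both signs doubles the error 3 c' x + 3, and x >= 1 absorbs the constant term. *)
exists (6 * c' + 6) => X X1; set x := X `^ 12^-1.
have x1 : 1 <= x by rewrite -(powRr0 X) ler_powR // ltW.
have Y0 : 0 <= Y X by rewrite hY // mulr_ge0 ?exprn_ge0 ?powR_ge0.
rewrite (counting_minimal Y0); last by move=> n; rewrite hh.
rewrite -EFinB abse_EFin lee_fin natrM -mulrBr normrM ger0_norm //.
have s0 : 0 <= c' * x by rewrite mulr_ge0 ?powR_ge0.
have sY : (c' * x) ^+ k.+2 = Y X by rewrite exprMn c'E hY.
have := kfree_count_natural s0 sY.
have : 0 <= c' by rewrite powR_ge0.
nra.
Qed.

End CountFamily.

(** * Real powers with exponent 1/m *)

Lemma powR_natV_expr (R : realType) (x : R) (m n : nat) : 0 <= x -> (0 < m)%N ->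
  (x `^ (m * n)%N%:R^-1) ^+ m = x `^ n%:R^-1.
Proof.
move=> x0 m0; rewrite -powR_mulrn ?powR_ge0 // -powRrM; congr (_ `^ _).
by rewrite natrM invfM mulrAC mulVf ?mul1r // pnatr_eq0 -lt0n.
Qed.

Lemma powR_natVK (R : realType) (x : R) (m : nat) : 0 <= x -> (0 < m)%N ->
  (x `^ m%:R^-1) ^+ m = x.
Proof.
by move=> x0 m0; have := powR_natV_expr 1 x0 m0; rewrite muln1 invr1 powRr1.
Qed.

(** * The equation of a given j-invariant *)

Lemma disc_intr (A B : int) : (4 * A ^+ 3 + 27 * B ^+ 2)%:~R =
  4 * A%:~R ^+ 3 + 27 * B%:~R ^+ 2 :> rat.
Proof. by rewrite intrD !intrM. Qed.

Lemma all_curvesE (A B : int) : all_curves (A, B) <->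
  4 * A%:~R ^+ 3 + 27 * B%:~R ^+ 2 != 0 :> rat.
Proof. by rewrite /all_curves /mkset /disc mulf_eq0 -disc_intr intq_eq0. Qed.

Lemma jinvE (A B : int) : jinv (A, B) = 1728 * (4 * A%:~R ^+ 3 /
  (4 * A%:~R ^+ 3 + 27 * B%:~R ^+ 2)).
Proof. by rewrite /jinv disc_intr intrM rmorphXn. Qed.

Lemma with_jE (A B : int) (j : rat) : with_j all_curves j (A, B) <->
  4 * A%:~R ^+ 3 + 27 * B%:~R ^+ 2 != 0 :> rat /\
  1728 * (4 * A%:~R ^+ 3 / (4 * A%:~R ^+ 3 + 27 * B%:~R ^+ 2)) = j.
Proof.
split=> -[D E]; (split; first exact/all_curvesE); first by rewrite -E jinvE.
by rewrite jinvE; exact: E.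
Qed.

(* Stated over an abstract field so that unification does not try to compute
   the numerals, as it would in [rat]. *)
Section JEquation.
Context {F : numFieldType} (x y : F).
Let D := 4 * x ^+ 3 + 27 * y ^+ 2.

Lemma jequation_0 : (D != 0 /\ 1728 * (4 * x ^+ 3 / D) = 0) <-> (y != 0 /\ x = 0).
Proof.
have c4 : 4 != 0 :> F by rewrite pnatr_eq0.
have c27 : 27 != 0 :> F by rewrite pnatr_eq0.
have c1728 : 1728 != 0 :> F by rewrite pnatr_eq0.
rewrite /D; split => [[D0 /eqP]|[y0 ->]].
  rewrite mulf_eq0 [_ / _ == 0]mulf_eq0 [4 * _ == 0]mulf_eq0 invr_eq0.
  rewrite (negbTE D0) (negbTE c4) (negbTE c1728) orbF expf_eq0 /=.
  move=> /eqP x0; split => //; apply: contraNneq D0 => ->.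
  by rewrite x0 !expr0n /= !mulr0 addr0.
by rewrite expr0n /= mulr0 add0r mul0r mulr0 mulf_neq0 // expf_neq0.
Qed.

Lemma jequation_1728 :
  (D != 0 /\ 1728 * (4 * x ^+ 3 / D) = 1728) <-> (x != 0 /\ y = 0).
Proof.
have c4 : 4 != 0 :> F by rewrite pnatr_eq0.
have c27 : 27 != 0 :> F by rewrite pnatr_eq0.
have c1728 : 1728 != 0 :> F by rewrite pnatr_eq0.
rewrite /D; split => [[D0]|[x0 ->]].
  rewrite -[RHS]mulr1 => /(mulfI c1728) /(congr1 (fun z => z * D)).
  rewrite /D divfK // mul1r => /eqP; rewrite -subr_eq0 opprD addNKr oppr_eq0.
  rewrite mulf_eq0 (negbTE c27) expf_eq0 /= => /eqP y0; split => //.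
  by apply: contraNneq D0 => ->; rewrite y0 !expr0n /= !mulr0 addr0.
have h : 4 * x ^+ 3 != 0 by rewrite mulf_neq0 // expf_neq0.
by rewrite expr0n /= mulr0 addr0 divff // mulr1.
Qed.

(** Clearing denominators gives 27 j y^2 = 4 (1728 - j) x^3. A zero x would force j = 0, and then a
    zero y would force j = 1728. Conversely D equals 1728 (4 x^3) / j, which is nonzero. *)
Lemma jequation_generic (j a : F) :
  a = 4 * (1728 - j) / (27 * j) -> j != 0 -> j != 1728 ->
  (D != 0 /\ 1728 * (4 * x ^+ 3 / D) = j) <->
  [/\ x != 0, y != 0 & y ^+ 2 = a * x ^+ 3].
Proof.
move=> -> j0 j1; have j1' : 1728 - j != 0 by rewrite subr_eq0 eq_sym.
have c4 : 4 != 0 :> F by rewrite pnatr_eq0.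
have c27 : 27 != 0 :> F by rewrite pnatr_eq0.
have c1728 : 1728 != 0 :> F by rewrite pnatr_eq0.
have K0 : 27 * j != 0 by rewrite mulf_neq0.
rewrite /D; split => [[D0 jE]|[x0 y0 yE]].
  have x0 : x != 0.
    by apply: contraNneq j0 => x0; rewrite -jE x0 expr0n /= mulr0 mul0r mulr0.
  have yE : y ^+ 2 = 4 * (1728 - j) / (27 * j) * x ^+ 3.
    apply: (mulfI K0); rewrite !mulrA [27 * j * 4]mulrC -!mulrA.
    have -> : 4 * (27 * (j * ((1728 - j) * ((27 * j)^-1 * x ^+ 3)))) =
      4 * ((1728 - j) * x ^+ 3) by field; rewrite j0.
    have : j * (4 * x ^+ 3 + 27 * y ^+ 2) = 1728 * (4 * x ^+ 3).
      by rewrite -jE -mulrA divfK.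
    rewrite mulrDr => /eqP; rewrite -subr_eq0 => /eqP h.
    by apply/eqP; rewrite -subr_eq0; apply/eqP; rewrite -[RHS]h; ring.
  split => //; apply: contraNneq j1' => y0; move: yE.
  rewrite y0 expr0n /= => /esym/eqP.
  rewrite mulf_eq0 [_ / _ == 0]mulf_eq0 [4 * _ == 0]mulf_eq0 invr_eq0.
  by rewrite (negbTE K0) expf_eq0 (negbTE x0) (negbTE c4) /= !orbF.
rewrite yE; have -> : 4 * x ^+ 3 + 27 * (4 * (1728 - j) / (27 * j) * x ^+ 3) =
   1728 * (4 * x ^+ 3) / j by field; rewrite j0.
have h : 4 * x ^+ 3 != 0 by rewrite mulf_neq0 // expf_neq0.
split; first by rewrite !mulf_neq0 // invr_eq0.
by move: h; set u := 4 * _ => u0; field; rewrite j0 u0.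
Qed.

End JEquation.

Lemma jratio_neq0 (F : numFieldType) (j : F) : j != 0 -> j != 1728 ->
  4 * (1728 - j) / (27 * j) != 0.
Proof.
move=> j0 j1; have j1' : 1728 - j != 0 by rewrite subr_eq0 eq_sym.
by rewrite mulf_neq0 ?invr_eq0 ?mulf_neq0 ?pnatr_eq0.
Qed.

(** * The families j = 0 and j = 1728 *)

Lemma with_j_A0 E : with_j all_curves 0 E <-> exists2 n, n != 0 & E = (0, n).
Proof.
case: E => A B; rewrite with_jE jequation_0 intq_eq0; split; last first.
  by move=> [n n0 [-> ->]].
by move=> [B0 /eqP]; rewrite intq_eq0 => /eqP ->; exists B.
Qed.

Lemma with_j_B0 E : with_j all_curves 1728 E <-> exists2 n, n != 0 & E = (n, 0).
Proof.
case: E => A B; rewrite with_jE jequation_1728 intq_eq0; split; last first.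
  by move=> [n n0 [-> ->]].
by move=> [A0 /eqP]; rewrite intq_eq0 => /eqP ->; exists A.
Qed.

Lemma minimal_A0 n : n != 0 -> minimal_curves (0, n) <-> kfree 6 `|n|.
Proof.
move=> n0; have n0' : (0 < `|n|)%N by rewrite absz_gt0.
split => [[_ h]|/(@kfreeP 6 _ isT n0') h].
  apply/kfreeP => // p pp; apply/negP => pn; apply: h; exists p.
  by split; [exact: pp|exact: dvdz0|exact: pn].
split; first by have [] : with_j all_curves 0 (0, n) by apply/with_j_A0; exists n.
by move=> [p [pp _ /= pn]]; have /negP := h p pp; apply.
Qed.

Lemma minimal_B0 n : n != 0 -> minimal_curves (n, 0) <-> kfree 4 `|n|.
Proof.
move=> n0; have n0' : (0 < `|n|)%N by rewrite absz_gt0.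
split => [[_ h]|/(@kfreeP 4 _ isT n0') h].
  apply/kfreeP => // p pp; apply/negP => pn; apply: h; exists p.
  by split; [exact: pp|exact: pn|exact: dvdz0].
split; first by have [] : with_j all_curves 1728 (n, 0) by apply/with_j_B0; exists n.
by move=> [p [pp /= pn _]]; have /negP := h p pp; apply.
Qed.

(** * Height conditions for j = 0 and j = 1728 *)

Section HeightBounds.
Context {R : realType} (alpha beta : R).
Hypotheses (alpha0 : 0 < alpha) (beta0 : 0 < beta).

Lemma powR_mul_expr_le (m : nat) (a z X : R) : (0 < m)%N -> 0 < a -> 0 <= z -> 0 <= X ->
  (a * z ^+ m <= X) = (z <= X `^ m%:R^-1 / a `^ m%:R^-1).
Proof.
move=> m0 a0 z0 X0; rewrite ler_pdivlMr ?powR_gt0 //.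
rewrite -[RHS](ler_pXn2r m0) ?nnegrE ?mulr_ge0 ?powR_ge0 //.
by rewrite exprMn !powR_natVK ?(ltW a0) // mulrC.
Qed.

Lemma height_A0 X n : 1 < X ->
  (height alpha beta (0, n) <= X) = (`|n|%N%:R <= X `^ 2^-1 / beta `^ 2^-1).
Proof.
move=> X1; have X0 : 0 <= X by rewrite ltW // (lt_trans ltr01).
rewrite /height /= ge_max normr0 expr0n /= mulr0 X0 /=.
by rewrite -powR_mul_expr_le // natr_absz intr_norm real_normK // num_real.
Qed.

Lemma height_B0 X n : 1 < X ->
  (height alpha beta (n, 0) <= X) = (`|n|%N%:R <= X `^ 3^-1 / alpha `^ 3^-1).
Proof.
move=> X1; have X0 : 0 <= X by rewrite ltW // (lt_trans ltr01).
rewrite /height /= ge_max expr0n /= mulr0 X0 andbT.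
by rewrite -powR_mul_expr_le // natr_absz intr_norm.
Qed.

End HeightBounds.

(** * Integral points of B^2 = a A^3 *)

Lemma Qint_dvdz (m d : int) : d != 0 ->
  (m%:~R / d%:~R : rat) \is a Num.int = (d %| m)%Z.
Proof.
move=> d0; have dq : d%:~R != 0 :> rat by rewrite intq_eq0.
apply/intrP/dvdzP => -[q].
  move=> /(congr1 (fun z => z * d%:~R)); rewrite divfK // -intrM => /intr_inj ->.
  by exists q.
by move=> ->; exists q; rewrite intrM mulfK.
Qed.

Section GenericFamily.
Variable a : rat.
Hypothesis a0 : a != 0.

(** The point with B/A = n N_a. Here [numq] only casts to integers, since both rationals are
    integral by [Qint_Nq]. *)
Definition generic_curve (n : int) : curve :=
  (numq ((n%:~R * Nq a) ^+ 2 / a), numq ((n%:~R * Nq a) ^+ 3 / a)).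

Let N0 : Nq a != 0. Proof. by rewrite gt_eqF // Nq_gt0. Qed.

Lemma generic_curve_intr n :
  (generic_curve n).1%:~R = (n%:~R * Nq a) ^+ 2 / a /\
  (generic_curve n).2%:~R = (n%:~R * Nq a) ^+ 3 / a.
Proof.
have [->|n0] := eqVneq n 0.
  by rewrite /generic_curve mulr0z mul0r !exprS !mul0r.
have s0 : n%:~R * Nq a != 0 by rewrite mulf_neq0 // intq_eq0.
have := Qint_Nq a0 s0; rewrite mulfK // intr_int => /esym/andP[].
by move=> /intrP[A AE] /intrP[B BE]; rewrite /generic_curve AE BE !numq_int.
Qed.

(** Recovers n from the point, hence injectivity; at n = 0 it relies on the convention 0/0 = 0. *)
Lemma generic_curve_ratio n :
  (generic_curve n).2%:~R / (generic_curve n).1%:~R = n%:~R * Nq a.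
Proof.
have [-> ->] := generic_curve_intr n; have [->|n0] := eqVneq n 0.
  by rewrite mulr0z mul0r !exprS !mul0r.
have s0 : n%:~R * Nq a != 0 by rewrite mulf_neq0 // intq_eq0.
by move: s0; set s := _ * Nq a => s0; field; rewrite a0 s0.
Qed.

Lemma generic_curve_inj : injective generic_curve.
Proof.
move=> m n E; have := generic_curve_ratio m; rewrite E generic_curve_ratio.
by move=> /(mulIf N0)/intr_inj.
Qed.

(** Replacing s = n N_a by s/p^2 divides s^2/a by p^4 and s^3/a by p^6, so [Qint_Nq] at s/p^2 says
    that both quotients are integral exactly when n/p^2 is. *)
Lemma generic_curve_dvd (n : int) (p : nat) : prime p -> n != 0 ->
  (((p ^ 4)%N%:Z %| (generic_curve n).1)%Z && ((p ^ 6)%N%:Z %| (generic_curve n).2)%Z)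
  = (p ^ 2 %| `|n|)%N.
Proof.
move=> pp n0; have p0 : p%:R != 0 :> rat by rewrite pnatr_eq0 -lt0n prime_gt0.
have pk k : (p ^ k)%N%:Z != 0 by rewrite -lt0n expn_gt0 prime_gt0.
have pE k : (p ^ k)%N%:Z%:~R = p%:R ^+ k :> rat by rewrite -pmulrn natrX.
have [A B] := generic_curve_intr n.
rewrite -[RHS]/((p ^ 2)%N%:Z %| n)%Z -!Qint_dvdz // A B !pE.
have s0 : n%:~R * Nq a / p%:R ^+ 2 != 0.
  by rewrite !mulf_neq0 ?invr_eq0 ?expf_neq0 // intq_eq0.
have := Qint_Nq a0 s0; rewrite !expr_div_n -!exprM.
rewrite ![_ / p%:R ^+ _ / a]mulrAC => <-.
by rewrite mulrAC mulfK.
Qed.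

(** For a point with nonzero coordinates, s = B/A satisfies s^2/a = A and s^3/a = B, so [Qint_Nq]
    makes s an integer multiple of N_a. *)
Lemma generic_curveP (A B : int) :
  [/\ A%:~R != 0 :> rat, B%:~R != 0 :> rat & B%:~R ^+ 2 = a * A%:~R ^+ 3] <->
  exists2 n, n != 0 & (A, B) = generic_curve n.
Proof.
split=> [[Aq Bq E]|[n n0 E]]; last first.
  have [] := generic_curve_intr n; rewrite -E /= => -> ->.
  have s0 : n%:~R * Nq a != 0 by rewrite mulf_neq0 // intq_eq0.
  split.
  - by rewrite mulf_neq0 ?invr_eq0 ?expf_neq0.
  - by rewrite mulf_neq0 ?invr_eq0 ?expf_neq0.
  - by rewrite !expr_div_n -!exprM; field.
have s0 : B%:~R / A%:~R != 0 :> rat by rewrite mulf_neq0 ?invr_eq0.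
have s2 : (B%:~R / A%:~R) ^+ 2 / a = A%:~R.
  by rewrite expr_div_n E; field; rewrite a0 Aq.
have s3 : (B%:~R / A%:~R) ^+ 3 / a = B%:~R.
  by rewrite exprSr mulrAC s2 mulrC divfK.
have := Qint_Nq a0 s0; rewrite s2 s3 !intr_int => /intrP[n nE].
have sE : B%:~R / A%:~R = n%:~R * Nq a by rewrite -nE divfK.
exists n; last by rewrite /generic_curve -sE s2 s3 !numq_int.
by apply: contraNneq s0 => n0; rewrite sE n0 mulr0z mul0r.
Qed.

Lemma minimal_generic_curve n : n != 0 -> all_curves (generic_curve n) ->
  minimal_curves (generic_curve n) <-> kfree 2 `|n|.
Proof.
move=> n0 all_n; have n0' : (0 < `|n|)%N by rewrite absz_gt0.
split => [[_ h]|/(@kfreeP 2 _ isT n0') h].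
  apply/(kfreeP _ n0') => [//|p pp]; apply/negP; rewrite -(generic_curve_dvd pp n0).
  by move=> /andP[p4 p6]; apply: h; exists p; split; [exact: pp|exact: p4|exact: p6].
split; first exact: all_n.
move=> [p [pp p4 p6]]; have /negP := h p pp; apply.
by rewrite -(generic_curve_dvd pp n0) p4 p6.
Qed.

(** Since |A|^3 = (|n| N_a)^6 / |a|^3 and B^2 = (|n| N_a)^6 / |a|^2, taking sixth roots produces the
    powers 1/2 and 1/3 of |a| in c(j), and the maximum becomes a minimum of bounds on |n|. *)
Lemma height_generic_curve (R : realType) (alpha beta X : R) n :
  0 < alpha -> 0 < beta -> 0 <= X ->
  (height alpha beta (generic_curve n) <= X) =
  (`|n|%N%:R <= Num.min (`|ratr a| `^ 2^-1 / (ratr (Nq a) * alpha `^ 6^-1))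
    (`|ratr a| `^ 3^-1 / (ratr (Nq a) * beta `^ 6^-1)) * X `^ 6^-1).
Proof.
move=> al0 be0 X0; have [] := generic_curve_intr n; rewrite /height.
set E := generic_curve n => AE BE; have Np := Nq_gt0 a0.
have NR : 0 < ratr (Nq a) :> R by rewrite ltr0q.
have aR : 0 < `|ratr a| :> R by rewrite normr_gt0 fmorph_eq0.
have AR : E.1%:~R = (n%:~R * ratr (Nq a)) ^+ 2 / ratr a :> R.
  by rewrite -(ratr_int R E.1) AE fmorph_div rmorphXn rmorphM /= ratr_int.
have BR : E.2%:~R = (n%:~R * ratr (Nq a)) ^+ 3 / ratr a :> R.
  by rewrite -(ratr_int R E.2) BE fmorph_div rmorphXn rmorphM /= ratr_int.
move: AR BR; set b := ratr a in aR *; set M := ratr (Nq a) in NR *; set x := n%:~R.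
have -> : `|n|%N%:R = `|x| :> R by rewrite natr_absz intr_norm.
move=> AR BR.
have xM : 0 <= `|x| * M by rewrite mulr_ge0 // ltW.
have A3 : `|E.1%:~R : R| ^+ 3 = (`|x| * M) ^+ 6 / `|b| ^+ 3.
  by rewrite AR normrM normfV normrX normrM (gtr0_norm NR) expr_div_n -exprM.
have B2 : (E.2%:~R : R) ^+ 2 = (`|x| * M) ^+ 6 / `|b| ^+ 2.
  rewrite -[LHS]real_normK ?num_real //.
  by rewrite BR normrM normfV normrX normrM (gtr0_norm NR) expr_div_n -exprM.
rewrite ge_max A3 B2 minr_pMl ?powR_ge0 // le_min.
(* One computation serves both bounds: m = 2 for alpha and m = 3 for beta. *)
have key (c : R) (m : nat) : 0 < c -> (0 < m)%N -> (m %| 6)%N ->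
  (c * ((`|x| * M) ^+ 6 / `|b| ^+ (6 %/ m)) <= X) =
  (`|x| <= `|b| `^ m%:R^-1 / (M * c `^ 6^-1) * X `^ 6^-1).
  move=> c0 m0 m6; rewrite mulrA ler_pdivrMr ?exprn_gt0 //.
  rewrite powR_mul_expr_le // ?mulr_ge0 ?exprn_ge0 //.
  have -> : (X * `|b| ^+ (6 %/ m)) `^ 6%:R^-1 = X `^ 6^-1 * `|b| `^ m%:R^-1.
    rewrite powRM ?exprn_ge0 ?(ltW aR) //; congr (_ * _).
    rewrite -powR_mulrn ?(ltW aR) // -powRrM; congr (_ `^ _).
    have m0' : m%:R != 0 :> R by rewrite pnatr_eq0 -lt0n.
    apply: (mulIf m0'); rewrite mulVf // mulrAC -natrM divnK // mulfV //.
  rewrite -ler_pdivlMr //; congr (_ <= _).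
  have := powR_gt0 6^-1 c0 => c6; field.
  by rewrite !gt_eqF.
by rewrite (key alpha 2%N) // (key beta 3%N).
Qed.

End GenericFamily.

(** * The family of a general j, and the theorem *)

Lemma a_of_j_neq0 j : j != 0 -> j != 1728 -> a_of_j j != 0.
Proof. exact: jratio_neq0. Qed.

Lemma a_of_jE j : a_of_j j = 4 * (1728 - j) / (27 * j).
Proof. exact: erefl. Qed.

Lemma with_j_generic j E : j != 0 -> j != 1728 ->
  with_j all_curves j E <->
  exists2 n, n != 0 & E = generic_curve (a_of_j j) n.
Proof.
move=> j0 j1; case: E => A B; apply: iff_trans (with_jE A B j) _.
apply: iff_trans (jequation_generic _ _ (a_of_jE j) j0 j1) _.
exact: (generic_curveP (a_of_j_neq0 j0 j1)).
Qed.

Lemma minimal_generic j n : j != 0 -> j != 1728 -> n != 0 ->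
  minimal_curves (generic_curve (a_of_j j) n) <-> kfree 2 `|n|.
Proof.
move=> j0 j1 n0; apply: (minimal_generic_curve (a_of_j_neq0 j0 j1) n0).
have [h _] : with_j all_curves j (generic_curve (a_of_j j) n).
  by apply/(with_j_generic _ j0 j1); exists n.
exact: h.
Qed.

Lemma height_generic (R : realType) (alpha beta : R) j X n :
  0 < alpha -> 0 < beta -> j != 0 -> j != 1728 -> 1 < X ->
  (height alpha beta (generic_curve (a_of_j j) n) <= X) =
  (`|n|%N%:R <= c_of_j j alpha beta * X `^ 6^-1).
Proof.
move=> al0 be0 j0 j1 X1; have X0 : 0 <= X by rewrite ltW // (lt_trans ltr01).
exact: (height_generic_curve (a_of_j_neq0 j0 j1) n al0 be0 X0).
Qed.

Lemma c_of_j_ge0 (R : realType) j (alpha beta : R) :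
  j != 0 -> j != 1728 -> 0 <= c_of_j j alpha beta.
Proof.
move=> j0 j1; have N0 := Nq_gt0 (a_of_j_neq0 j0 j1).
have NR : 0 <= ratr (Nq (a_of_j j)) :> R by rewrite ler0q ltW.
rewrite /c_of_j le_min; apply/andP.
by split; apply: divr_ge0; rewrite ?powR_ge0 //; apply: mulr_ge0; rewrite ?powR_ge0.
Qed.

Theorem theorem2p3 (R : realType) (alpha beta : R) (j : rat)
    (halpha : 1 <= alpha) (hbeta : 1 <= beta) :
  (exists C : R, forall X : R, 1 < X ->
     (`| @counting _ R (up_to_height alpha beta (with_j minimal_curves j) X)
         - (if j == 0 then 2 / (beta `^ 2^-1 * zeta 6) * X `^ 2^-1
            else if j == 1728 then 2 / (alpha `^ 3^-1 * zeta 4) * X `^ 3^-1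
            else 2 * c_of_j j alpha beta / zeta 2 * X `^ 6^-1)%:E |
      <= (C * X `^ 12^-1)%:E)%E)
  /\
  (forall X : R, 1 < X ->
     @counting _ R (up_to_height alpha beta (with_j all_curves j) X)
     = (if j == 0 then 2 * Num.floor (X `^ 2^-1 / beta `^ 2^-1)
        else if j == 1728 then 2 * Num.floor (X `^ 3^-1 / alpha `^ 3^-1)
        else 2 * Num.floor (c_of_j j alpha beta * X `^ 6^-1))%:~R%:E).
Proof.
have al0 : 0 < alpha by exact: lt_le_trans halpha.
have be0 : 0 < beta by exact: lt_le_trans hbeta.
(* Used with (m, k) = (2, 6), (3, 4), (6, 2): each main term is a power of X^(1/12) whose exponent
   is the order of power-freeness. *)
have X12 (X : R) (m k : nat) : 1 < X -> (k * m = 12)%N -> (0 < k)%N ->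
    X `^ m%:R^-1 = (X `^ 12^-1) ^+ k.
  move=> X1 E k0; rewrite -(@powR_natV_expr _ X k m) ?E //.
  by rewrite ltW // (lt_trans ltr01).
have inj_A0 : injective (fun n : int => ((0, n) : curve)) by move=> m n [].
have inj_B0 : injective (fun n : int => ((n, 0) : curve)) by move=> m n [].
(* Hides the numeral, which [eqVneq j 0] would otherwise compare with [0]. *)
have [c cE] : exists c : rat, c = 1728.
  exact: ex_intro erefl.
rewrite -cE; have [->|j0] := eqVneq j 0.
  split; last first.
    move=> X X1; have Y0 : 0 <= X `^ 2^-1 / beta `^ 2^-1 by rewrite divr_ge0 ?powR_ge0.
    exact: (counting_all inj_A0 with_j_A0 Y0 (fun n => height_A0 alpha be0 n X1)).
  have c0 : 0 <= (beta `^ 2^-1)^-1 by rewrite invr_ge0 powR_ge0.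
  have [|X n X1|C hC] := counting_minimal_asymptotic inj_A0 with_j_A0 minimal_A0
    (Y := fun X => X `^ 2^-1 / beta `^ 2^-1) c0 (alpha := alpha) (beta := beta).
  - by move=> X X1; rewrite mulrC (X12 X 2%N 6%N).
  - exact: height_A0.
  exists C => X X1; have := hC X X1; congr (`|_ - _%:E| <= _)%E.
  by rewrite invfM; ring.
have [->|] := eqVneq j c; rewrite cE; last move=> j1.
  split; last first.
    move=> X X1; have Y0 : 0 <= X `^ 3^-1 / alpha `^ 3^-1 by rewrite divr_ge0 ?powR_ge0.
    exact: (counting_all inj_B0 with_j_B0 Y0 (fun n => height_B0 beta al0 n X1)).
  have c0 : 0 <= (alpha `^ 3^-1)^-1 by rewrite invr_ge0 powR_ge0.
  have [|X n X1|C hC] := counting_minimal_asymptotic inj_B0 with_j_B0 minimal_B0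
    (Y := fun X => X `^ 3^-1 / alpha `^ 3^-1) c0 (alpha := alpha) (beta := beta).
  - by move=> X X1; rewrite mulrC (X12 X 3%N 4%N).
  - exact: height_B0.
  exists C => X X1; have := hC X X1; congr (`|_ - _%:E| <= _)%E.
  by rewrite invfM; ring.
have inj_g := generic_curve_inj (a_of_j_neq0 j0 j1).
have wj E := with_j_generic E j0 j1.
have mj n := @minimal_generic j n j0 j1.
have hj X n := @height_generic _ alpha beta j X n al0 be0 j0 j1.
have c0 := c_of_j_ge0 alpha beta j0 j1.
split; last first.
  move=> X X1; have Y0 : 0 <= c_of_j j alpha beta * X `^ 6^-1 by rewrite mulr_ge0 ?powR_ge0.
  exact: (counting_all inj_g wj Y0 (fun n => hj X n X1)).
have [|X n X1|C hC] := counting_minimal_asymptotic inj_g wj mj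
  (Y := fun X => c_of_j j alpha beta * X `^ 6^-1) c0 (alpha := alpha) (beta := beta).
- by move=> X X1; rewrite (X12 X 6%N 2%N).
- exact: hj.
exists C => X X1; have := hC X X1; congr (`|_ - _%:E| <= _)%E.
by ring.
Qed.
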